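(* Let $M,N\ge0$ be real numbers and let $n\ge0$ be an integer. The generalized Chebyshev-I polynomials $\mathscr{T}_0^{(M,N)},\dots,\mathscr{T}_n^{(M,N)}$ of degree less than or equal to $n$ can be expressed in the Bernstein basis of fixed degree $n$ by $$\mathscr{T}_r^{(M,N)}(x)=\sum_{i=0}^{n}N_{r,i}^{n}\,B_i^n(x),\qquad r=0,1,\dots,n,$$ where $$N_{r,i}^{n}=\mu_{r,i}^{n}+\sum_{k=0}^{r}\lambda_k\,\mu_{k,i}^{n}$$ and, for $0\le r,i\le n$, $$\mu_{r,i}^{n}=\frac{(2r)!}{2^{2r}(r!)^{2}}\sum_{k=\max(0,i+r-n)}^{\min(i,r)}(-1)^{r-k}\,\frac{\binom{n-r}{i-k}\binom{2r}{r}\binom{2r}{2k}}{2^{2r}\binom{n}{i}}.$$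
   Context: The Bernstein polynomials of degree $n$ are $B_k^n(x)=\binom{n}{k}x^k(1-x)^{n-k}$ for $k=0,1,\dots,n$, $x\in[0,1]$. For real $M,N\ge0$ and integers $k\ge 0$, $$\lambda_k=\frac{4M}{(2k-3)(k-1)!}+\frac{4N}{(2k-3)(k-1)!}+\frac{4MN}{(k-1)!\,(k-2)!},$$ with the convention $1/m!=0$ for negative integers $m$. Chebyshev polynomials of the first kind: $T_k$ is taken on $[0,1]$ and normalized so that its Bernstein form is $$T_k(x)=\sum_{i=0}^{k}(-1)^{k-i}\eta_{i,k}B_i^k(x),\qquad \eta_{i,k}=\frac{\binom{2k}{k}\binom{2k}{2i}}{2^{2k}\binom{k}{i}}\quad(0\le i\le k);$$ equivalently, $T_k(x)=2^{-2k}\binom{2k}{k}\cos(k\theta)$ where $2x-1=\cos\theta$. Double factorials: $(2n)!!=2^n n!$ and $(2n-1)!!=(2n)!/(2^n n!)$, with $0!!=(-1)!!=1$. The generalized Chebyshev-I Koornwinder's type polynomials (generalized Chebyshev-I polynomials) are $$\mathscr{T}_n^{(M,N)}(x)=\frac{(2n-1)!!}{(2n)!!}T_n(x)+\sum_{k=0}^{n}\frac{(2k)!\,\lambda_k}{2^{2k}(k!)^2}T_k(x),\qquad n=0,1,2,\dots,$$ so that $$\mathscr{T}_{r}^{(M,N)}(x)=\frac{(2r-1)!!}{(2r)!!}\sum_{i=0}^{r}(-1)^{r-i}\eta_{i,r}B_{i}^{r}(x)+\sum_{k=0}^{r}\frac{(2k)!\lambda_{k}}{2^{2k}(k!)^{2}}\sum_{j=0}^{k}(-1)^{k-j}\eta_{j,k}B_{j}^{k}(x).$$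 *)

(* Defs.v *)
From mathcomp Require Import all_boot all_order all_algebra.
From mathcomp Require Import all_classical all_reals all_analysis.
From mathcomp Require complex.
From mathcomp Require Import zify ring lra.

Set Implicit Arguments.
Unset Strict Implicit.
Unset Printing Implicit Defensive.

Import Order.TTheory GRing.Theory Num.Theory.

Local Open Scope ring_scope.

(* Polynomial functions on [0, 1] are represented by elements of {poly R}:
   two polynomials that agree on [0, 1] are equal. *)
Definition bernstein (R : realType) (n k : nat) : {poly R} :=
  'C(n, k)%:R *: ('X^k * (1 - 'X) ^+ (n - k)).

(* (2n-1)!! is written dfact (2 * n).-1; for n = 0 the predecessor truncates
   to 0, and the value is still (-1)!! = 1. *)
Fixpoint dfact (n : nat) : nat :=
  match n with
  | m.+2 => m.+2 * dfact m
  | _ => 1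
  end.

Lemma dfact_even (n : nat) : dfact (2 * n) = (2 ^ n * n`!)%N.
Proof.
elim: n => [//|n IH].
by rewrite mulnS add2n [LHS]/= IH factS expnS -add2n -mulnS mulnACA.
Qed.

Lemma dfact_odd (n : nat) :
  dfact (2 * n).-1 = ((2 * n)`! %/ (2 ^ n * n`!))%N.
Proof.
have H m : (dfact m * dfact m.-1 = m`!)%N.
  elim: m => [//|[//|m] IH].
  by rewrite factS -IH [dfact m.+2]/= [m.+2.-1]/= mulnAC -mulnA.
by rewrite -H dfact_even mulKn // muln_gt0 expn_gt0 fact_gt0.
Qed.

(* 1 / m!, with the convention 1 / m! = 0 for m < 0. *)
Definition invfact (R : realType) (m : int) : R :=
  match m with
  | Posz p => (p`!)%:R^-1
  | Negz _ => 0
  end.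

Definition lambda (R : realType) (M N : R) (k : nat) : R :=
  4 * M / (2 * k%:R - 3) * invfact R (k%:Z - 1)
  + 4 * N / (2 * k%:R - 3) * invfact R (k%:Z - 1)
  + 4 * M * N * invfact R (k%:Z - 1) * invfact R (k%:Z - 2).

Definition eta (R : realType) (i k : nat) : R :=
  'C(2 * k, k)%:R * 'C(2 * k, 2 * i)%:R / (2 ^+ (2 * k) * 'C(k, i)%:R).

(* The first-kind Chebyshev polynomial transported to [0, 1] and scaled by
   2^(-2k) binom(2k, k); see chebyshevT_cos. *)
Definition chebyshevT (R : realType) (k : nat) : {poly R} :=
  \sum_(0 <= i < k.+1) ((-1) ^+ (k - i) * eta R i k) *: bernstein R k i.

Section ChebyshevCos.
Import complex.
Local Open Scope complex_scope.

Let deMoivre (R : realType) (u : R) (m : nat) :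
  (cos u +i* sin u) ^+ m = cos (u *+ m) +i* sin (u *+ m).
Proof.
elim: m => [|m IH]; first by rewrite expr0 mulr0n cos0 sin0.
rewrite exprS IH mulrS cosD sinD; apply/eqP; rewrite eq_complex /=.
by rewrite eqxx [X in _ == X]addrC mulrC [sin u * _]mulrC eqxx.
Qed.

Let sum_parity (V : nmodType) (F : nat -> V) (k : nat) :
  \sum_(0 <= j < (2 * k).+1) F j =
  \sum_(0 <= i < k.+1) F (2 * i)%N + \sum_(0 <= i < k) F (2 * i).+1.
Proof.
elim: k => [|k IH]; first by rewrite !big_nat1 big_nil addr0.
rewrite mulnS add2n big_nat_recr //= big_nat_recr //= IH.
rewrite [\sum_(0 <= i < k.+2) _]big_nat_recr //=.
rewrite [\sum_(0 <= i < k.+1) F (2 * i).+1]big_nat_recr //= mulnS add2n.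
by rewrite -!addrA; congr (_ + _); rewrite [RHS]addrCA [F _ + _]addrC.
Qed.

Let cos_double_expansion (R : realType) (u : R) (k : nat) :
  cos (u *+ (2 * k)) = \sum_(0 <= i < k.+1)
    (-1) ^+ (k - i) * 'C(2 * k, 2 * i)%:R *
      ((cos u ^+ 2) ^+ i * (sin u ^+ 2) ^+ (k - i)).
Proof.
have -> : cos (u *+ (2 * k)) = complex.Re ((cos u +i* sin u) ^+ (2 * k)).
  by rewrite deMoivre.
have ReD (x y : R[i]) : complex.Re (x + y) = complex.Re x + complex.Re y.
  by case: x; case: y.
have isE d : ('i%C * (sin u)%:C) ^+ (2 * d) =
    real_complex R ((- sin u ^+ 2) ^+ d).
  by rewrite exprM rmorphXn rmorphN rmorphXn /= (exprMn 2) sqr_i mulN1r.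
have cE j : (cos u)%:C ^+ j = real_complex R (cos u ^+ j) by rewrite rmorphXn.
have -> : cos u +i* sin u = 'i%C * (sin u)%:C + (cos u)%:C.
  by rewrite [LHS]complexE addrC.
rewrite exprDn.
rewrite -(big_mkord xpredT (fun j : nat =>
  ('i%C * (sin u)%:C) ^+ (2 * k - j) * (cos u)%:C ^+ j *+ 'C(2 * k, j))).
rewrite sum_parity ReD !(big_morph _ ReD (erefl : complex.Re 0 = 0)).
rewrite [X in _ + X]big_nat [X in _ + X]big1 ?addr0 => [|i /andP[_ lik]].
  apply: eq_bigr => i _.
  rewrite -mulnBr isE cE -rmorphM -rmorphMn /= -[LHS]mulr_natr exprM [LHS]mulrAC.
  by rewrite (exprNn (sin u ^+ 2)); ring.
have -> : (2 * k - (2 * i).+1 = (2 * (k - i).-1).+1)%N by lia.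
rewrite exprS isE cE -!mulrA -!rmorphM -mulrnAr -rmorphMn /=.
by rewrite mul0r mul1r subr0.
Qed.

Lemma chebyshevT_cos (R : realType) (k : nat) (x theta : R) :
  2 * x - 1 = cos theta ->
  (chebyshevT R k).[x] =
    'C(2 * k, k)%:R / 2 ^+ (2 * k) * cos (theta *+ k).
Proof.
move=> xE; set u := theta / 2.
have uE : theta = u *+ 2 by rewrite -mulr_natr divfK ?pnatr_eq0.
have x1 : x = cos u ^+ 2.
  by move: xE; rewrite uE cos_mulr2n -mulr_natl => xE; lra.
have x2 : 1 - x = sin u ^+ 2 by rewrite x1 -(cos2Dsin2 u) addrC addKr.
rewrite uE -mulrnA cos_double_expansion /chebyshevT horner_sum mulr_sumr.
apply: eq_big_nat => i /andP[_ ik].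
rewrite /bernstein !hornerE /= -x1 -x2 /eta.
have ? : 'C(k, i)%:R != 0 :> R by rewrite pnatr_eq0 -lt0n bin_gt0 -ltnS.
have ? : 2 ^+ (2 * k) != 0 :> R by rewrite expf_neq0 ?pnatr_eq0.
by field; apply/andP.
Qed.

End ChebyshevCos.

Definition koornwinderT (R : realType) (M N : R) (n : nat) : {poly R} :=
  ((dfact (2 * n).-1)%:R / (dfact (2 * n))%:R) *: chebyshevT R n
  + \sum_(0 <= k < n.+1)
      (((2 * k)`!)%:R * lambda M N k / (2 ^+ (2 * k) * (k`!)%:R ^+ 2))
        *: chebyshevT R k.

(* The truncated subtraction i + r - n is max(0, i + r - n). *)
Definition mu (R : realType) (n r i : nat) : R :=
  ((2 * r)`!)%:R / (2 ^+ (2 * r) * (r`!)%:R ^+ 2) *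
  \sum_(i + r - n <= k < (minn i r).+1)
    (-1) ^+ (r - k) *
    ('C(n - r, i - k)%:R * 'C(2 * r, r)%:R * 'C(2 * r, 2 * k)%:R
      / (2 ^+ (2 * r) * 'C(n, i)%:R)).

Definition bernstein_coef (R : realType) (M N : R) (n r i : nat) : R :=
  mu R n r i + \sum_(0 <= k < r.+1) lambda M N k * mu R n k i.

(* Main.v *)
Require Import Defs.
From mathcomp Require Import all_boot all_order all_algebra.
From mathcomp Require Import all_classical all_reals all_analysis.
From mathcomp Require Import zify ring.

Import Order.TTheory GRing.Theory Num.Theory.
Local Open Scope ring_scope.

(** Everything is linear in the polynomials T_k, so it suffices to expand each
    single T_k with k <= n in the Bernstein basis of degree n. That is degree
    elevation: multiplying B_k^r by 1 = (X + (1 - X))^(n - r) and applying the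
    binomial theorem gives
      B_k^r = sum_i C(r,k) C(n-r,i-k) / C(n,i) B_i^n
    ([bernstein_elevation]). Substituting it in the Bernstein form of T_r and
    exchanging the two sums, the coefficient of B_i^n is a sum over k <= r, in
    which the factor C(r,k) cancels the denominator of eta_{k,r}, and in which
    only max(0,i+r-n) <= k <= min(i,r) contributes; up to the factor
    (2r)! / (2^(2r) r!^2), this is mu_{r,i}^n ([chebyshevT_elevation]).
    The Koornwinder polynomial of degree r then follows termwise, because the
    factor (2r-1)!!/(2r)!! of its leading T_r is the same
    (2r)! / (2^(2r) r!^2) ([dfact_ratio]). *)

Lemma dfact_mul_pred (m : nat) : (dfact m * dfact m.-1 = m`!)%N.
Proof.
elim: m => [//|[//|m] IH].
by rewrite factS -IH [dfact m.+2]/= [m.+2.-1]/= mulnAC -mulnA.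
Qed.

(** Since (2r-1)!! (2r)!! = (2r)!, the ratio is (2r)! over the square of
    (2r)!! = 2^r r!. *)
Lemma dfact_ratio (R : realType) (r : nat) :
  (dfact (2 * r).-1)%:R / (dfact (2 * r))%:R =
  ((2 * r)`!)%:R / (2 ^+ (2 * r) * (r`!)%:R ^+ 2) :> R.
Proof.
have dE : (dfact (2 * r))%:R = 2 ^+ r * (r`!)%:R :> R.
  by rewrite dfact_even natrM natrX.
have n0 : 2 ^+ r != 0 :> R by rewrite expf_neq0 ?pnatr_eq0.
have f0 : (r`!)%:R != 0 :> R by rewrite pnatr_eq0 -lt0n fact_gt0.
rewrite -dfact_mul_pred natrM dE mulnC exprM.
by field; rewrite n0 f0.
Qed.

(** Degree elevation from r to n. *)
Lemma bernstein_elevation (R : realType) (n r k : nat) :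
  (k <= r)%N -> (r <= n)%N ->
  bernstein R r k = \sum_(0 <= i < n.+1 | (k <= i)%N)
    ('C(r, k)%:R * 'C(n - r, i - k)%:R / 'C(n, i)%:R) *: bernstein R n i.
Proof.
move=> kr rn.
rewrite -(big_nat_widenl k 0 n.+1 xpredT) // -{2}[k]add0n big_addn.
(* The sum now runs over j = i - k, and C(n-r,j) vanishes for j > n - r. *)
rewrite (@big_cat_nat _ _ _ (n - r).+1) //=; last by lia.
rewrite [X in _ + X]big_nat [X in _ + X]big1 ?addr0; last first.
  by move=> j /andP[jn _]; rewrite addnK [X in _ * X%:R]bin_small // mulr0 mul0r scale0r.
have elevate (p : {poly R}) : p = p * (1 - 'X + 'X) ^+ (n - r).
  by rewrite subrK expr1n mulr1.
rewrite /bernstein [X in _ *: X = _]elevate [(_ + 'X) ^+ _]exprDn big_mkord mulr_sumr.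
rewrite scaler_sumr; apply: eq_bigr => -[j /= jn] _.
have C0 : 'C(n, j + k)%:R != 0 :> R by rewrite pnatr_eq0 -lt0n bin_gt0; lia.
rewrite addnK scalerA divfK // -scalerA; congr (_ *: _).
have -> : (n - (j + k) = (r - k) + (n - r - j))%N by lia.
by rewrite -mulr_natl scaler_nat -mulr_natl !exprD; ring.
Qed.

(** The range of k in mu_{r,i}^n is 0 <= k <= r with k <= i, less the indices
    where C(n-r,i-k) = 0. *)
Lemma mu_widen (R : realType) (n r i : nat) (a : nat -> R) :
  (r <= n)%N ->
  \sum_(i + r - n <= k < (minn i r).+1) 'C(n - r, i - k)%:R * a k =
  \sum_(0 <= k < r.+1 | (k <= i)%N) 'C(n - r, i - k)%:R * a k.
Proof.
move=> rn.
rewrite (big_nat_widenl (i + r - n) 0) //.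
rewrite (big_nat_widen 0 _ r.+1) ?ltnS ?geq_minr //.
rewrite big_nat_cond [RHS]big_nat_cond big_mkcond [RHS]big_mkcond /=.
apply: eq_bigr => k _.
case: (leqP (i + r - n) k) => hk.
  by congr (if _ then _ else _); lia.
rewrite andbF /= bin_small ?mul0r ?if_same //; lia.
Qed.

Lemma chebyshevT_elevation (R : realType) (n r : nat) :
  (r <= n)%N ->
  (((2 * r)`!)%:R / (2 ^+ (2 * r) * (r`!)%:R ^+ 2)) *: chebyshevT R r =
  \sum_(0 <= i < n.+1) mu R n r i *: bernstein R n i.
Proof.
move=> rn; rewrite /mu; set c := _ / _.
under [RHS]eq_bigr do rewrite -scalerA.
rewrite -scaler_sumr; congr (_ *: _); rewrite /chebyshevT.
under eq_big_nat => k kr.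
  rewrite (bernstein_elevation R n r k) // scaler_sumr big_mkcond /=.
  over.
rewrite exchange_big /=; apply: eq_big_nat => i /andP[_ ilen].
pose a k : R := (-1) ^+ (r - k) * ('C(2 * r, r)%:R * 'C(2 * r, 2 * k)%:R
  / (2 ^+ (2 * r) * 'C(n, i)%:R)).
have -> : \sum_(i + r - n <= k < (minn i r).+1) (-1) ^+ (r - k) *
    ('C(n - r, i - k)%:R * 'C(2 * r, r)%:R * 'C(2 * r, 2 * k)%:R
      / (2 ^+ (2 * r) * 'C(n, i)%:R)) =
    \sum_(i + r - n <= k < (minn i r).+1) 'C(n - r, i - k)%:R * a k.
  by apply: eq_bigr => k _; rewrite /a -!mulrA mulrCA.
rewrite mu_widen // -big_mkcond scaler_suml.
rewrite big_nat_cond [RHS]big_nat_cond.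
apply: eq_bigr => k /andP[/andP[_ kr] _].
rewrite scalerA /a /eta; congr (_ *: _).
have n0 : 2 ^+ (2 * r) != 0 :> R by rewrite expf_neq0 ?pnatr_eq0.
have C0 : 'C(n, i)%:R != 0 :> R by rewrite pnatr_eq0 -lt0n bin_gt0.
have D0 : 'C(r, k)%:R != 0 :> R by rewrite pnatr_eq0 -lt0n bin_gt0.
by field; rewrite n0 C0 D0.
Qed.

Theorem corollary2p1 (R : realType) (M N : R) (n : nat)
    (hM : 0 <= M) (hN : 0 <= N) (r : nat) (hr : (r <= n)%N) :
  koornwinderT M N r =
  \sum_(0 <= i < n.+1) bernstein_coef M N n r i *: bernstein R n i.
Proof.
rewrite /koornwinderT /bernstein_coef dfact_ratio.
rewrite (chebyshevT_elevation R n r) //.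
under [RHS]eq_bigr do rewrite scalerDl scaler_suml.
rewrite big_split exchange_big /=; congr (_ + _).
apply: eq_big_nat => k /andP[_ kr].
rewrite [_%:R * _]mulrC -mulrA -scalerA.
rewrite (chebyshevT_elevation R n k) //; last by lia.
by rewrite scaler_sumr; apply: eq_bigr => i _; rewrite scalerA.
Qed.
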